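(* Let $z>0$ be fixed and let $(a_n)_{n\ge1}$, $(b_n)_{n\ge0}$ be the three-term recurrence coefficients of the monic orthogonal polynomials with respect to $\langle \mathbf{u}_z,p\rangle=\int_0^\infty p(x)e^{-zx^4}\,dx$. Then, as $n\to\infty$, $$a_n\sim\sqrt{\frac{n}{140z}},\qquad b_n\sim 2\,\sqrt[4]{\frac{n}{140z}}.$$
   Context: The functional $\mathbf{u}_z$ is positive definite; $(P_n)_{n\ge0}$ denotes its sequence of monic orthogonal polynomials. The coefficients $a_n$ ($n\ge1$) and $b_n$ ($n\ge0$) are defined by $xP_n(x)=P_{n+1}(x)+b_nP_n(x)+a_nP_{n-1}(x)$, with $P_{-1}=0$, $P_0=1$. The notation $f_n\sim g_n$ means $f_n/g_n\to1$ as $n\to\infty$. *)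

(* Defs.v *)
From HB Require Import structures.
From mathcomp Require Import all_boot all_order all_algebra.
From mathcomp Require Import all_classical all_reals all_analysis.

Set Implicit Arguments.
Unset Strict Implicit.
Unset Printing Implicit Defensive.

Import Order.TTheory GRing.Theory Num.Theory.
Import numFieldNormedType.Exports.

Local Open Scope classical_set_scope.
Local Open Scope ring_scope.

(* For [0 < z] the integrand is integrable for every [p], so the real-valued
   Lebesgue integral is never a default value. *)
Definition freud_functional (R : realType) (z : R) (p : {poly R}) : R :=
  \int[lebesgue_measure]_(x in `[0, +oo[) (p.[x] * expR (- (z * x ^+ 4))).

(* The last clause is automatic for a positive definite functional; it is part
   of the usual definition of orthogonality for a general functional. *)
Definition monic_orthogonal (R : realType) (u : {poly R} -> R)
    (P : nat -> {poly R}) : Prop :=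
  [/\ forall n, P n \is monic,
      forall n, size (P n) = n.+1,
      forall m n, m <> n -> u (P m * P n) = 0
    & forall n, u (P n ^+ 2) != 0].

(* The [if] encodes the convention P_{-1} = 0; the value [a 0] is irrelevant. *)
Definition three_term_recurrence (R : realType) (P : nat -> {poly R})
    (a b : nat -> R) : Prop :=
  forall n, 'X * P n =
    P n.+1 + b n *: P n + (if n is m.+1 then a n *: P m else 0).

(* A possibly vanishing [g 0] is harmless: only large indices matter. *)
Definition asymp_equiv (R : realType) (f g : nat -> R) : Prop :=
  (fun n => f n / g n) @ \oo --> (1 : R).

(* Main.v *)
Require Import Defs.
From HB Require Import structures.
From mathcomp Require Import all_boot all_order all_algebra.
From mathcomp Require Import all_classical all_reals all_analysis.
From mathcomp Require Import measurable_realfun ring lra zify.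

(** Write [w(x) = exp(- z x^4)] on the half-line and symmetrize:
    the substitution [x = t^2] turns the problem into that of the even weight
    [|t| exp(- z t^8)], whose monic orthogonal polynomials [S_n] satisfy
    [t S_n = S_(n+1) + g_n S_(n-1)], with [P_n(t^2) = S_(2n)(t)],
    [a_n = g_(2n) g_(2n-1)] and [b_n = g_(2n+1) + g_(2n)].  Integration by parts
    gives the Freud equations
      [8 z F_n(g) = n + (1 if n is odd, else 0)],
    where [F_n] is the sum over the 35 lattice paths of the monomials of degree 4
    in [g_(n-3), ..., g_(n+3)].

    All monomials of [F_n] are positive, contain [g_n], and [g_n^4] is one of
    them; hence [g_n / n^(1/4)] lies between two positive constants.  Moreover
    [F_n = g_n dPhi/dg_n] for a function [Phi] that is a sum of exponentials of
    linear forms in the [ln g_k], hence convex in these variables (this is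
    Magnus' argument for Freud's conjecture).  With
    [d_k = ln g_k - ln (n / (280 z)) / 4] on a window around [n] and [F_k]
    rescaled accordingly, the sum of the [d_k (F_k - 35)] is therefore at least
    [c > 0] times the sum of the [d_k^2] up to boundary terms, and it tends to 0
    by the Freud equations.  So the energy
    [sum d_k^2] of a window is at most [theta < 1] times that of the next larger
    window, up to [o(1)].  As the [d_k] are bounded, iterating gives [d_n -> 0]. *)

Set Implicit Arguments.
Unset Strict Implicit.
Unset Printing Implicit Defensive.

Import Order.TTheory GRing.Theory Num.Theory.
Import numFieldNormedType.Exports.

Local Open Scope classical_set_scope.
Local Open Scope ring_scope.

(** * The functional *)

Section Functional.
Context {R : realType}.
Implicit Types (z x : R) (p q : {poly R}).

Let mu := @lebesgue_measure R.

(** For [x > 1], [x^k <= x^(4 (k+1))], and one term of the exponential series at [z x^4] controls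
    this power; for [x <= 1] the bound 1 suffices. *)
Lemma ler_Xn_expR4 z k : 0 < z -> exists2 M, 0 < M &
  forall x, 0 <= x -> x ^+ k * expR (- (z * x ^+ 4)) <= M.
Proof.
move=> z0; pose C : R := k.+1`!%:R / z ^+ k.+1.
have C0 : 0 < C by rewrite divr_gt0// ?exprn_gt0// ltr0n fact_gt0.
exists (1 + C); first by rewrite addr_gt0.
move=> x x0; set y := z * x ^+ 4.
have y0 : 0 <= y by rewrite mulr_ge0 ?exprn_ge0// ltW.
rewrite expRN ler_pdivrMr ?expR_gt0//.
have le1 : 1 <= expR y by rewrite -expR0 ler_expR.
have leC : x ^+ k.+1 ^+ 4 <= C * expR y.
  have := expR_ge1Dxn k y0; rewrite {1}/y exprMn exprAC.
  move/(le_trans (ler_wpDl ler01 (lexx _))).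
  rewrite ler_pdivrMr ?ltr0n ?fact_gt0// => h.
  by rewrite /C mulrAC ler_pdivlMr ?exprn_gt0// mulrC (mulrC _%:R).
case: (lerP x 1) => x1.
  apply: (@le_trans _ _ 1); first by rewrite exprn_ile1.
  by rewrite mulrDl mul1r (le_trans le1)// lerDl mulr_ge0 ?expR_ge0// ltW.
apply: (@le_trans _ _ (C * expR y)); last by rewrite ler_wpM2r ?expR_ge0// lerDr.
apply: le_trans leC; rewrite -exprM ler_eXn2l//.
by lia.
Qed.


Lemma cvg_Xn_expR4 z k : 0 < z ->
  x ^+ k * expR (- (z * x ^+ 4)) @[x --> +oo] --> (0 : R).
Proof.
move=> z0; have [M M0 hM] := ler_Xn_expR4 k.+1 z0.
apply/cvgrPdist_le => e e0; near=> x.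
have x0 : 0 < x by near: x; exact: nbhs_pinfty_gt.
rewrite sub0r normrN ger0_norm; last first.
  by rewrite mulr_ge0 ?exprn_ge0 ?expR_ge0// ltW.
rewrite -(ler_pM2l x0) mulrA -exprS (le_trans (hM _ (ltW x0)))//.
rewrite -ler_pdivrMr//; near: x; exact: nbhs_pinfty_ge.
Unshelve. all: by end_near. Qed.

Lemma is_derive_Xn_expR4 z k x :
  is_derive x 1 (fun x : R => - (x ^+ k.+1 * expR (- (z * x ^+ 4))))
   ((4 * z * x ^+ k.+4 - k.+1%:R * x ^+ k) * expR (- (z * x ^+ 4))).
Proof.
have h : is_derive x 1 (fun x : R => - (z * x ^+ 4)) (- (z * (4 * x ^+ 3))).
  apply: is_derive_eq; rewrite /GRing.scale/= !exprS expr0; ring.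
pose g (x : R) := - (z * x ^+ 4).
have h1 : is_derive x 1 (fun x : R => x ^+ k.+1) (k.+1%:R * x ^+ k).
  have := is_deriveX k.+1 (is_derive_id x (1 : R)); rewrite [_ *: _]mulr1.
  by rewrite exprfctE.
have h2 := @is_derive1_comp _ expR g _ _ _ (is_derive_expR (g x)) h.
apply: (@is_derive_eq _ _ _ _ _ _ _ _ (is_deriveN (is_deriveM h1 h2))).
rewrite /GRing.scale /= -/(g x).
rewrite !(exprS x); generalize (x ^+ k) (expR (g x)) (k.+1%:R : R) => A B C.
ring.

Qed.

Lemma continuous_horner_expR4 z p :
  continuous (fun x : R => p.[x] * expR (- (z * x ^+ 4))).
Proof.
move=> x; apply: cvgM; first exact: continuous_horner.
apply: (@continuous_comp _ _ _ (fun x : R => - (z * x ^+ 4)) expR).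
  apply: cvgN; apply: cvgM; first exact: cvg_cst.
  exact: exprn_continuous.
exact: continuous_expR.
Qed.

Lemma integrable_oneDsqrV : mu.-integrable `[0, +oo[ (EFin \o (fun x : R => (oneDsqr x)^-1)).
Proof.
apply/integrableP; split.
  apply/measurable_EFinP; apply: measurable_funTS.
  by apply: continuous_measurable_fun; exact: continuous_oneDsqrV.
under eq_integral => x _.
  rewrite /= ger0_norm; last by rewrite invr_ge0 (le_trans ler01)// oneDsqr_ge1.
  over.
by rewrite /= integral0y_oneDsqr ltry.
Qed.

Lemma integrable_scale_oneDsqrV (c : R) :
  mu.-integrable `[0, +oo[ (EFin \o (fun x : R => c * (oneDsqr x)^-1)).
Proof. exact: (integrableZl _ c integrable_oneDsqrV). Qed.

(** The bounds for the exponents [k] and [k + 2] add up to the integrable majorant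
    [(M + N) / (1 + x^2)]. *)
Lemma integrable_Xn_expR4 z k : 0 < z ->
  mu.-integrable `[0, +oo[ (EFin \o (fun x : R => x ^+ k * expR (- (z * x ^+ 4)))).
Proof.
move=> z0; have [M M0 hM] := ler_Xn_expR4 k z0.
have [N N0 hN] := ler_Xn_expR4 k.+2 z0.
apply: (@le_integrable _ _ _ mu _ _ _ (EFin \o (fun x : R => (M + N) * (oneDsqr x)^-1))) => //.
- apply/measurable_EFinP; apply: measurable_funTS.
  apply: continuous_measurable_fun => x.
  have := @continuous_horner_expR4 z 'X^k x.
  by under [X in continuous_at _ X -> _]eq_fun do rewrite hornerXn.
- move=> x /=; rewrite in_itv/= andbT => x0; rewrite lee_fin.
  have h0 : 0 <= x ^+ k * expR (- (z * x ^+ 4)) by rewrite mulr_ge0 ?exprn_ge0 ?expR_ge0.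
  have p0 : 0 < oneDsqr x by rewrite (lt_le_trans ltr01)// oneDsqr_ge1.
  rewrite (ger0_norm h0) ger0_norm; last first.
    by rewrite mulr_ge0 ?invr_ge0 ?ltW// addr_gt0.
  rewrite ler_pdivlMr// /oneDsqr mulrDr mulr1 lerD ?hM//.
  by rewrite mulrAC -exprD addn2 hN.
- exact: integrable_scale_oneDsqrV.
Qed.

Lemma integrable_horner_expR4 z p : 0 < z ->
  mu.-integrable `[0, +oo[ (EFin \o (fun x : R => p.[x] * expR (- (z * x ^+ 4)))).
Proof.
move=> z0.
have -> : (EFin \o (fun x : R => p.[x] * expR (- (z * x ^+ 4)))) =
   (fun x => \sum_(i <- index_enum 'I_(size p)) (p`_i)%:E * ((EFin \o (fun x : R => x ^+ i * expR (- (z * x ^+ 4)))%R) x))%E.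
  apply/funext => x /=; rewrite horner_coef mulr_suml -sumEFin.
  by apply: eq_bigr => i _ /=; rewrite -mulrA EFinM.
apply: integrable_sum => // i _.
by apply: integrableZl => //; exact: integrable_Xn_expR4.
Qed.

Lemma freud_functionalD z p q : 0 < z ->
  freud_functional z (p + q) = freud_functional z p + freud_functional z q.
Proof.
move=> z0; rewrite /freud_functional -RintegralD//; last 2 first.
- exact: integrable_horner_expR4.
- exact: integrable_horner_expR4.
by apply: eq_Rintegral => x _; rewrite hornerD mulrDl.
Qed.

Lemma freud_functionalZ z c p : 0 < z ->
  freud_functional z (c *: p) = c * freud_functional z p.
Proof.
move=> z0; rewrite /freud_functional -RintegralZl//; last exact: integrable_horner_expR4.
by apply: eq_Rintegral => x _; rewrite hornerZ -mulrA.
Qed.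

Lemma freud_functional_ge0 z p : (forall x, 0 <= x -> 0 <= p.[x]) ->
  0 <= freud_functional z p.
Proof.
move=> p0; apply: Rintegral_ge0 => x /=; rewrite in_itv/= andbT => x0.
by rewrite mulr_ge0 ?expR_ge0 ?p0.
Qed.

(* The integrand is the derivative of a function vanishing at both ends; adding
   a multiple of 1/(1 + x^2) makes it nonnegative, as the fundamental theorem
   of calculus on a half-line requires. *)
Lemma freud_functional_Pearson z k : 0 < z ->
  freud_functional z ((4 * z) *: 'X^(k.+4) - k.+1%:R *: 'X^k) = 0.
Proof.
move=> z0; set p := (X in freud_functional z X).
have [M M0 hM] := ler_Xn_expR4 k z0.
have [N N0 hN] := ler_Xn_expR4 k.+2 z0.
(* With this [K], [K / (1 + x^2)] dominates the only negative term [(k+1) x^k exp(- z x^4)], so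
   [f >= 0] on the half-line. *)
pose K := k.+1%:R * (M + N).
pose f x := p.[x] * expR (- (z * x ^+ 4)) + K * (oneDsqr x)^-1.
pose F x := - (x ^+ k.+1 * expR (- (z * x ^+ 4))) + K * atan x.
have K0 : 0 <= K by rewrite mulr_ge0// ltW// addr_gt0.
have dF x : is_derive x 1 F (f x).
  have h := is_deriveD (is_derive_Xn_expR4 z k x) (is_deriveZ K (is_derive1_atan x)).
  apply: (@is_derive_eq _ _ _ _ _ _ _ _ h).
  by rewrite /f /p hornerD hornerN !hornerZ !hornerXn.
have cf : continuous f.
  move=> x; apply: cvgD; first exact: continuous_horner_expR4.
  apply: cvgM; first exact: cvg_cst.
  exact: continuous_oneDsqrV.
have Kint : \int[mu]_(x in `[0, +oo[) (K * (oneDsqr x)^-1) = K * (pi / 2).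
  rewrite RintegralZl//; last exact: integrable_oneDsqrV.
  by rewrite /Rintegral integral0y_oneDsqr.
have : \int[mu]_(x in `[0, +oo[) f x = (- 0 + K * (pi / 2)) - F 0.
  apply: Rintegral_ge0_continuous_FTC2y.
  - move=> x x0; rewrite /f /p.
    have p0 : 0 < oneDsqr x by rewrite (lt_le_trans ltr01)// oneDsqr_ge1.
    have h : k.+1%:R * (x ^+ k * expR (- (z * x ^+ 4))) <= K * (oneDsqr x)^-1.
      rewrite -(mulrA _ (M + N)) ler_wpM2l// ler_pdivlMr// /oneDsqr mulrDr mulr1.
      by rewrite lerD ?hM// mulrAC -exprD addn2 hN.
    have h' : 0 <= (4 * z * x ^+ k.+4) * expR (- (z * x ^+ 4)).
      apply: mulr_ge0; last exact: expR_ge0.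
      by apply: mulr_ge0; [lra|exact: exprn_ge0].
    rewrite hornerD hornerN !hornerZ !hornerXn mulrBl -(mulrA k.+1%:R).
    by move: h h'; lra.
  - exact: continuous_subspaceT.
  - apply: cvgD; first by apply: cvgN; exact: cvg_Xn_expR4.
    apply: cvgM; first exact: cvg_cst.
    exact: cvgy_atan.
  - by move=> x _; apply: ex_derive.
  - apply: cvg_at_right_filter; apply: differentiable_continuous.
    by apply/derivable1_diffP; apply: ex_derive.
  - by move=> x _; rewrite derive1E; exact: derive_val.
(* The value [K * (pi / 2)] occurs on both sides, and [F 0 = 0]. *)
rewrite /f RintegralD//=; last 2 first.
- exact: integrable_horner_expR4.
- exact: integrable_scale_oneDsqrV.
rewrite Kint /F atan0 exprS mul0r mul0r !mulr0 !oppr0 !addr0 add0r => h.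
by rewrite /freud_functional; move: h; lra.
Qed.

End Functional.

(** * The Freud system *)

Section FreudSystem.
Context {R : realType}.
Implicit Types (y d : nat -> R).

(* [phi_i] is [y_i] times the derivative in [y_i] of the convex-in-logarithms
   generating function [y0^4/4 + y0^3 y1 + y0 y1^3 + 3/2 y0^2 y1^2
   + y0^2 y1 y2 + 2 y0 y1^2 y2 + y0 y1 y2^2 + y0 y1 y2 y3]. *)
Definition phi0 (a b c e : R) := a ^+ 4 + 3 * a ^+ 3 * b + a * b ^+ 3
  + 3 * a ^+ 2 * b ^+ 2 + 2 * a ^+ 2 * b * c + 2 * a * b ^+ 2 * c
  + a * b * c ^+ 2 + a * b * c * e.
Definition phi1 (a b c e : R) := a ^+ 3 * b + 3 * a * b ^+ 3
  + 3 * a ^+ 2 * b ^+ 2 + a ^+ 2 * b * c + 4 * a * b ^+ 2 * c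
  + a * b * c ^+ 2 + a * b * c * e.
Definition phi2 (a b c e : R) := a ^+ 2 * b * c + 2 * a * b ^+ 2 * c
  + 2 * a * b * c ^+ 2 + a * b * c * e.
Definition phi3 (a b c e : R) := a * b * c * e.

(* The right-hand side of the Freud equation of index [m + 3]; the shift avoids
   truncated subtraction. *)
Definition freud_sum y m :=
  phi0 (y m.+3) (y m.+4) (y m.+4.+1) (y m.+4.+2)
  + phi1 (y m.+2) (y m.+3) (y m.+4) (y m.+4.+1)
  + phi2 (y m.+1) (y m.+2) (y m.+3) (y m.+4)
  + phi3 (y m) (y m.+1) (y m.+2) (y m.+3).

(** Both bounds come from [1 + t <= expR t] at [t] and at [- t]. The first makes the energy
    densities coercive, the second makes the boundary terms quadratic. *)
Lemma expR_secant_bounds (M t : R) : `|t| <= M ->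
  expR (- M) * t ^+ 2 <= t * (expR t - 1) /\ `|expR t - 1| <= expR M * `|t|.
Proof.
move=> tM; have [t0|t0] := lerP 0 t.
- have tM' : t <= M by rewrite (le_trans (ler_norm _)).
  have h1 : t <= expR t - 1 by have := expR_ge1Dx t; lra.
  have h2 : expR t - 1 <= expR M * t.
    have := expR_ge1Dx (- t); rewrite expRN => h.
    have : expR t - 1 <= expR t * t.
      have e0 := expR_gt0 t.
      have : expR t * (1 - t) <= expR t * (expR t)^-1 by rewrite ler_pM2l// addrC in h *.
      by rewrite divff ?gt_eqF//; lra.
    move/le_trans; apply; apply: ler_wpM2r => //; by rewrite ler_expR.
  split; last by rewrite !ger0_norm//; lra.
  have hM : expR (- M) <= 1 by rewrite -expR0 ler_expR; lra.
  have := ler_wpM2r (sqr_ge0 t) hM; have := ler_wpM2l t0 h1; lra.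
- have tM' : - t <= M by rewrite (le_trans (ler_norm _))// normrN.
  have h1 : 1 - expR t <= - t by have := expR_ge1Dx t; lra.
  have M0 : 0 <= M by lra.
  have h2 : expR (- M) * - t <= 1 - expR t.
    have e0 := expR_gt0 t.
    have : expR t * (- t) <= 1 - expR t.
      have := expR_ge1Dx (- t); rewrite expRN => h.
      have : expR t * (1 - t) <= expR t * (expR t)^-1 by rewrite ler_pM2l.
      by rewrite divff ?gt_eqF//; lra.
    apply: le_trans; apply: ler_wpM2r; first lra.
    by rewrite ler_expR; lra.
  split; first by have := @ler_wpM2l _ (- t) _ _ _ h2; rewrite expr2; lra.
  have e1 : expR t <= 1 by rewrite -expR0 ler_expR ltW.
  have hM : 1 <= expR M by rewrite -expR0 ler_expR; lra.
  rewrite (ltr0_norm t0) ler0_norm; last lra.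
  have := @ler_wpM2r _ (- t) _ _ _ hM; lra.
Qed.

Lemma expR_secant_ge0 (t : R) : 0 <= t * (expR t - 1).
Proof.
have [h _] := expR_secant_bounds (lexx `|t|).
by apply: le_trans h; rewrite mulr_ge0 ?expR_ge0 ?sqr_ge0.
Qed.

(** * Energy densities and boundary fluxes *)

Section LocalEstimates.
Variable d : nat -> R.
Let y k := expR (d k).

(* The constants [14, 14, 6, 1] are the values of the [phi_i] at [(1, 1, 1, 1)];
   they sum to 35. *)
Definition flux i k := match i with
  | 0 => d k * (phi0 (y k) (y k.+1) (y k.+2) (y k.+3) - 14)
  | 1 => d k.+1 * (phi1 (y k) (y k.+1) (y k.+2) (y k.+3) - 14)
  | 2 => d k.+2 * (phi2 (y k) (y k.+1) (y k.+2) (y k.+3) - 6)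
  | _ => d k.+3 * (phi3 (y k) (y k.+1) (y k.+2) (y k.+3) - 1)
  end.

Definition energy_density k := flux 0 k + flux 1 k + flux 2 k + flux 3 k.

Definition boundary_flux m := flux 1 m.+2 + flux 2 m.+1 + flux 2 m.+2
  + flux 3 m + flux 3 m.+1 + flux 3 m.+2.

(* Regrouping the terms of the Freud sum by monomials instead of by index only
   costs a telescoping difference. *)
Lemma freud_sum_flux m : d m.+3 * (freud_sum y m - 35) =
  energy_density m.+3 + (boundary_flux m - boundary_flux m.+1).
Proof. rewrite /energy_density /boundary_flux /flux /freud_sum; ring. Qed.

(** The [phi_i] are logarithmic partial derivatives of one generating function, so weighting them
    with the [d_i] multiplies each monomial by its own logarithm. *)
Lemma energy_density_ge M k : `|d k| <= M ->
  4 * expR (- (4 * M)) * d k ^+ 2 <= energy_density k.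
Proof.
move=> dM.
have h4 : `|4 * d k| <= 4 * M by rewrite normrM ger0_norm// ler_pM2l.
have [h _] := expR_secant_bounds h4.
(* Each monomial contributes a term [t * (expR t - 1) >= 0]; the one coming
   from [y_k ^+ 4] is bounded below by the square. *)
pose t i j l n := i%:R * d k + j%:R * d k.+1 + l%:R * d k.+2 + n%:R * d k.+3.
have E i j l n : expR (t i j l n) = y k ^+ i * y k.+1 ^+ j * y k.+2 ^+ l * y k.+3 ^+ n.
  by rewrite /t !expRD !expRM_natl.
have P i j l n : 0 <= t i j l n * (expR (t i j l n) - 1) := expR_secant_ge0 _.
have -> : energy_density k = d k * (expR (4 * d k) - 1)
  + t 3 1 0 0 * (expR (t 3 1 0 0) - 1) + t 1 3 0 0 * (expR (t 1 3 0 0) - 1)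
  + 3 / 2 * (t 2 2 0 0 * (expR (t 2 2 0 0) - 1))
  + t 2 1 1 0 * (expR (t 2 1 1 0) - 1) + 2 * (t 1 2 1 0 * (expR (t 1 2 1 0) - 1))
  + t 1 1 2 0 * (expR (t 1 1 2 0) - 1) + t 1 1 1 1 * (expR (t 1 1 1 1) - 1).
  rewrite !E expRM_natl -/(y k) /t /energy_density /flux /phi0 /phi1 /phi2 /phi3.
  by field.
have := P 3 1 0 0; have := P 1 3 0 0; have := P 2 2 0 0; have := P 2 1 1 0.
have := P 1 2 1 0; have := P 1 1 2 0; have := P 1 1 1 1.
move: h; rewrite exprMn; lra.
Qed.

Definition energy p q := \sum_(p <= j < q) d j ^+ 2.

Lemma energy_cat p q r : (p <= q)%N -> (q <= r)%N ->
  energy p r = energy p q + energy q r.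
Proof. by move=> pq qr; rewrite /energy (big_cat_nat pq qr). Qed.

Lemma energy_ge0 p q : 0 <= energy p q.
Proof. by apply: sumr_ge0 => i _; exact: sqr_ge0. Qed.

Lemma le_energy p q p' q' : (p' <= p)%N -> (p <= q)%N -> (q <= q')%N ->
  energy p q <= energy p' q'.
Proof.
move=> h1 h2 h3.
rewrite (energy_cat h1 (leq_trans h2 h3)) (energy_cat h2 h3).
by have := energy_ge0 p' p; have := energy_ge0 q q'; lra.
Qed.

(** A monomial differs from 1 by at most [4 expR (4 M) s], with [s] the sum of the four [|d_j|]. The
    constant is [4 * 14 * 4]: degree 4, at most 14 monomials with multiplicity, and
    [s^2 <= 4 * energy k k.+4]. *)
Lemma flux_le M k i : (forall j, (j < 4)%N -> `|d (k + j)%N| <= M) ->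
  `|flux i k| <= 224 * expR (4 * M) * energy k k.+4.
Proof.
move=> dM.
have d0 : `|d k| <= M by have := dM 0 isT; rewrite addn0.
have d1 : `|d k.+1| <= M by have := dM 1 isT; rewrite addn1.
have d2 : `|d k.+2| <= M by have := dM 2 isT; rewrite addn2.
have d3 : `|d k.+3| <= M by have := dM 3 isT; rewrite addn3.
pose s := `|d k| + `|d k.+1| + `|d k.+2| + `|d k.+3|.
pose U := expR (4 * M) * (4 * s).
pose mono a b c e := y k ^+ a * y k.+1 ^+ b * y k.+2 ^+ c * y k.+3 ^+ e.
have B a b c e : (a + b + c + e = 4)%N -> - U <= mono a b c e - 1 <= U.
  move=> abce; rewrite -ler_norml.
  pose t := a%:R * d k + b%:R * d k.+1 + c%:R * d k.+2 + e%:R * d k.+3.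
  have -> : mono a b c e = expR t by rewrite /t !expRD !expRM_natl.
  have tri : `|t| <= a%:R * `|d k| + b%:R * `|d k.+1| + c%:R * `|d k.+2| + e%:R * `|d k.+3|.
    rewrite /t; do 3 (apply: (le_trans (ler_normD _ _)); apply: lerD;
      last by rewrite normrM normr_nat).
    by rewrite normrM normr_nat.
  have abceR : a%:R + b%:R + c%:R + e%:R = 4 :> R by rewrite -!natrD abce.
  have [a0 b0 c0 e0] : [/\ 0 <= a%:R :> R, 0 <= b%:R :> R, 0 <= c%:R :> R & 0 <= e%:R :> R].
    by split; exact: ler0n.
  have t4 : `|t| <= 4 * M.
    rewrite (le_trans tri)// -abceR !mulrDl.
    by rewrite !lerD// ler_wpM2l.
  have [_ h] := expR_secant_bounds t4.
  rewrite (le_trans h)// /U ler_wpM2l ?expR_ge0// (le_trans tri)// /s.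
  have le4 n : n \in [:: a; b; c; e] -> n%:R <= 4 :> R.
    by rewrite ler_nat !inE => /or4P[] /eqP->; clear -abce; lia.
  rewrite !mulrDr !lerD// ler_wpM2r// le4// !inE eqxx ?orbT//.
have s2 : s ^+ 2 <= 4 * energy k k.+4.
  rewrite /energy; do 4 (rewrite big_nat_recr ?leqW//=); rewrite big_geq// add0r.
  rewrite -(real_normK (num_real (d k))) -(real_normK (num_real (d k.+1))).
  rewrite -(real_normK (num_real (d k.+2))) -(real_normK (num_real (d k.+3))) /s.
  move: `|d k| `|d k.+1| `|d k.+2| `|d k.+3| => p q r u.
  have := sqr_ge0 (p - q); have := sqr_ge0 (p - r); have := sqr_ge0 (p - u).
  have := sqr_ge0 (q - r); have := sqr_ge0 (q - u); have := sqr_ge0 (r - u); nra.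
have s0 : 0 <= s by rewrite /s !addr_ge0.
have U0 : 0 <= U by rewrite /U mulr_ge0 ?expR_ge0 ?mulr_ge0.
have main x f : `|x| <= s -> - (14 * U) <= f <= 14 * U ->
    `|x * f| <= 224 * expR (4 * M) * energy k k.+4.
  move=> xs; rewrite -ler_norml => fU; rewrite normrM.
  apply: (@le_trans _ _ (s * (14 * U))); first exact: ler_pM.
  rewrite (_ : s * _ = 56 * expR (4 * M) * s ^+ 2); last by rewrite /U; ring.
  rewrite (_ : 224 * _ * _ = 56 * expR (4 * M) * (4 * energy k k.+4)); last by ring.
  by rewrite ler_wpM2l// mulr_ge0// expR_ge0.
have n0 := normr_ge0 (d k); have n1 := normr_ge0 (d k.+1).
have n2 := normr_ge0 (d k.+2); have n3 := normr_ge0 (d k.+3).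
have := B 4 0 0 0 erefl; have := B 3 1 0 0 erefl; have := B 1 3 0 0 erefl.
have := B 2 2 0 0 erefl; have := B 2 1 1 0 erefl; have := B 1 2 1 0 erefl.
have := B 1 1 2 0 erefl; have := B 1 1 1 1 erefl.
rewrite /mono !expr0 !expr1 !mulr1 => /andP[? ?] /andP[? ?] /andP[? ?] /andP[? ?] /andP[? ?] /andP[? ?] /andP[? ?] /andP[? ?].
rewrite /flux /phi0 /phi1 /phi2 /phi3.
by case: i => [|[|[|i]]]; (apply: main; first by rewrite /s; lra); apply/andP; split; lra.
Qed.

(** Six fluxes, each with the constant 224 of [flux_le]. *)
Definition boundary_gain (M : R) : R := 1344 * expR (4 * M).

Lemma boundary_gain_gt0 M : 0 < boundary_gain M.
Proof. by apply: mulr_gt0; [rewrite ltr0n|exact: expR_gt0]. Qed.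

Lemma boundary_flux_le M m : (forall j, (j < 6)%N -> `|d (m + j)%N| <= M) ->
  `|boundary_flux m| <= boundary_gain M * energy m m.+4.+2.
Proof.
move=> dM; rewrite /boundary_flux /boundary_gain.
have F i j : (j < 3)%N -> `|flux i (m + j)| <= 224 * expR (4 * M) * energy m m.+4.+2.
  move=> j3; apply: (@le_trans _ _ (224 * expR (4 * M) * energy (m + j) (m + j).+4)).
    by apply: flux_le => l l4; rewrite -addnA; apply: dM; lia.
  apply: ler_wpM2l; last by apply: le_energy; lia.
    by apply: mulr_ge0; [rewrite ler0n|exact: expR_ge0].
have := F 1%N 2%N isT; have := F 2%N 1%N isT; have := F 2%N 2%N isT.
have := F 3%N 0%N isT; have := F 3%N 1%N isT; have := F 3%N 2%N isT.
rewrite addn0 addn1 addn2 !ler_norml.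
move=> /andP[? ?] /andP[? ?] /andP[? ?] /andP[? ?] /andP[? ?] /andP[? ?].
by apply/andP; split; lra.
Qed.

(** Hole filling: summing [freud_sum_flux] bounds the inner energy by that of two collars of width
    6; adding [boundary_gain M] times the inner energy to both sides completes the collars to the
    whole window. *)
Lemma energy_contraction M eta p q : (p + 6 <= q)%N -> 0 <= eta ->
  (forall j, (p <= j < q + 6)%N -> `|d j| <= M) ->
  (forall m, (p <= m < q)%N -> `|freud_sum y m - 35| <= eta) ->
  (4 * expR (- (4 * M)) + boundary_gain M) * energy (p + 6) q <=
  boundary_gain M * energy p (q + 6) + (q - p)%:R * (M * eta).
Proof.
move=> pq eta0 dM fM.
have T k : `|d k| <= M -> 4 * expR (- (4 * M)) * d k ^+ 2 <= energy_density k.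
  exact: energy_density_ge.
have G m : (forall j, (j < 6)%N -> `|d (m + j)%N| <= M) ->
    `|boundary_flux m| <= boundary_gain M * energy m m.+4.+2.
  exact: boundary_flux_le.
have c0 : 0 <= 4 * expR (- (4 * M)) by rewrite mulr_ge0 ?expR_ge0.
move: (4 * expR (- (4 * M))) (boundary_gain M) c0 T G => c K c0 T G.
have pq' : (p <= q)%N by lia.
have sumE : \sum_(p <= m < q) d m.+3 * (freud_sum y m - 35) =
    \sum_(p <= m < q) energy_density m.+3 + (boundary_flux p - boundary_flux q).
  under eq_bigr do rewrite freud_sum_flux.
  rewrite big_split/=; congr (_ + _).
  rewrite (telescope_sumr_eq (fun m => - boundary_flux m) _ pq').
    by rewrite opprK addrC.
  by move=> m _; rewrite opprK addrC.
have h1 : \sum_(p <= m < q) d m.+3 * (freud_sum y m - 35) <= (q - p)%:R * (M * eta).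
  rewrite mulr_natl -sumr_const_nat; apply: ler_sum_nat => m mpq.
  apply: le_trans (ler_norm _) _; rewrite normrM ler_pM// ?fM//.
  by apply: dM; lia.
(* The densities cover the indices from [p + 3] to [q + 2], which include those from [p + 6] to
   [q - 1]. *)
have h2 : c * energy (p + 6) q <= \sum_(p <= m < q) energy_density m.+3.
  apply: (@le_trans _ _ (c * energy p.+3 q.+3)).
    by rewrite ler_wpM2l//; apply: le_energy; lia.
  rewrite /energy big_add1/= mulr_sumr !big_add1/=; apply: ler_sum_nat => m mpq.
  by apply: T; apply: dM; lia.
have h3 : `|boundary_flux p| <= K * energy p (p + 6).
  rewrite addnC; apply: G => j j6; apply: dM; lia.
have h4 : `|boundary_flux q| <= K * energy q (q + 6).
  rewrite (addnC q); apply: G => j j6; apply: dM; lia.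
have e : energy p (q + 6) = energy p (p + 6) + energy (p + 6) q + energy q (q + 6).
  have i1 : (p <= p + 6)%N by lia.
  have i2 : (p + 6 <= q + 6)%N by lia.
  have i3 : (q <= q + 6)%N by lia.
  by rewrite (energy_cat i1 i2) (energy_cat pq i3) addrA.
move: h3 h4; rewrite !ler_norml => /andP[? ?] /andP[? ?].
rewrite e; lra.
Qed.

End LocalEstimates.
End FreudSystem.

(** * Decay of the energy by iterated contraction *)

Section EnergyDecay.
Context {R : realType}.

Lemma ler_bernoulli (x : R) n : 0 <= x -> 1 + n%:R * x <= (1 + x) ^+ n.
Proof.
move=> x0; elim: n => [|n IHn]; first by rewrite mul0r addr0 expr0.
have x1 : 0 <= 1 + x by lra.
rewrite exprS (le_trans _ (ler_wpM2l x1 IHn))// -natr1.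
have : 0 <= n%:R * x * x by rewrite !mulr_ge0.
lra.
Qed.

(** Write [t = r / (1 + x)] with [r] halfway between [t] and 1: by Bernoulli, [(1 + x)^i] absorbs
    the linear factor, and [r^i] still tends to 0. *)
Lemma geometric_beats_linear (t C e : R) : 0 < t < 1 -> 0 <= C -> 0 < e ->
  exists i, t ^+ i * (C * (12 * i%:R + 3)) <= e.
Proof.
move=> /andP[t0 t1] C0 e0.
pose r := (1 + t) / 2; pose x := r / t - 1.
have r0 : 0 < r by rewrite /r; lra.
have r1 : r < 1 by rewrite /r; lra.
have x0 : 0 < x by rewrite /x subr_gt0 ltr_pdivlMr// mul1r /r; lra.
pose D := C * (12 / x + 3).
have D0 : 0 <= D by rewrite mulr_ge0// addr_ge0// divr_ge0// ltW.
have rn : `|r| < 1 by rewrite gtr0_norm.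
have [i hi] : exists i, r ^+ i * (D + 1) <= e.
  have /cvgrPdist_le /(_ (e / (D + 1))) := cvg_expr rn.
  case; first by rewrite divr_gt0//; lra.
  move=> i _ /(_ i (leqnn i)) /=; rewrite sub0r normrN ger0_norm ?exprn_ge0 ?(ltW r0)// => h.
  have D1 : 0 < D + 1 by lra.
  by exists i; rewrite -(ler_pdivlMr _ _ D1).
exists i; apply: le_trans hi.
have x1e : 1 + x = r / t by rewrite /x; ring.
have -> : t = r / (1 + x) by rewrite x1e invf_div mulrCA divff ?mulr1 ?gt_eqF.
have b := ler_bernoulli i (ltW x0).
have x1 : 0 < (1 + x) ^+ i by rewrite exprn_gt0//; lra.
rewrite expr_div_n -mulrA ler_wpM2l ?exprn_ge0 ?(ltW r0)//.
rewrite [leLHS]mulrC ler_pdivrMr//.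
have -> : 12 * i%:R + 3 = 12 / x * (i%:R * x) + 3 :> R by field; rewrite gt_eqF.
apply: (@le_trans _ _ (D * (1 + x) ^+ i)); last by rewrite ler_wpM2r ?ltW//; lra.
rewrite /D -[leRHS]mulrA ler_wpM2l//.
apply: (@le_trans _ _ ((12 / x + 3) * (1 + i%:R * x))); last first.
  by rewrite ler_wpM2l// addr_ge0// divr_ge0// ltW.
have : 0 <= i%:R * x by rewrite mulr_ge0// ltW.
have : 0 <= 12 / x by rewrite divr_ge0// ltW.
move: (12 / x) (i%:R * x) => p q p0 q0.
have := mulr_ge0 p0 q0; lra.
Qed.

(** The number of contraction steps depends on [eta] and [M] but not on [n], so control on windows
    of fixed width [J] around [n] is enough. *)
Lemma energy_vanishes (d : nat -> nat -> R) (M : R) : 0 < M ->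
  (forall J, \forall n \near \oo,
    forall k, (n <= k + J)%N -> (k <= n + J)%N -> `|d n k| <= M) ->
  (forall J (eta : R), 0 < eta -> \forall n \near \oo,
    forall m, (n <= m + J)%N -> (m <= n + J)%N ->
    `|freud_sum (fun k => expR (d n k)) m - 35| <= eta) ->
  forall eta, 0 < eta -> \forall n \near \oo, energy (d n) (n - 1) (n + 2) <= eta.
Proof.
move=> M0 dM fM.
pose c : R := 4 * expR (- (4 * M)); pose K := boundary_gain M.
have c0 : 0 < c by rewrite mulr_gt0 ?expR_gt0.
have K0 : 0 < K := boundary_gain_gt0 M.
have cK0 : 0 < c + K by rewrite addr_gt0.
pose t := K / (c + K).
have t01 : 0 < t < 1 by rewrite divr_gt0//= ltr_pdivrMr// mul1r; lra.
(* Each step of [j] widens the window by one collar on both sides; [j = 0] gives the indices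
   [n - 1], [n], [n + 1]. *)
pose W j n := energy (d n) (n - (6 * j + 1)) (n + (6 * j + 2)).
have step j eta : 0 < eta -> \forall n \near \oo, W j n <= t * W j.+1 n + eta.
  move=> eta0; pose N := (12 * j + 9)%N.
  have NM0 : 0 < N%:R * M + 1 by rewrite ltr_wpDl// mulr_ge0// ltW.
  (* [N] counts the Freud equations that are summed; with this tolerance their total error, divided
     by [c + K], is at most [eta]. *)
  have eps0 : 0 < eta * (c + K) / (N%:R * M + 1) by rewrite divr_gt0// mulr_gt0.
  apply: filterS3 (dM (6 * j + 8)%N) (fM (6 * j + 8)%N _ eps0) (nbhs_infty_ge (6 * j + 7)) => n /= hd hf hn.
  have pq : (n - (6 * j + 7) + 6 <= n + (6 * j + 2))%N by clear -hn; lia.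
  have := energy_contraction pq (ltW eps0).
  move=> /(_ (d n) M).
  have -> : (n - (6 * j + 7) + 6 = n - (6 * j + 1))%N by clear -hn; lia.
  have -> : (n + (6 * j + 2) + 6 = n + (6 * j.+1 + 2))%N by clear; lia.
  have -> : (n - (6 * j + 7) = n - (6 * j.+1 + 1))%N by clear; lia.
  have -> : (n + (6 * j + 2) - (n - (6 * j.+1 + 1)) = N)%N by rewrite /N; clear -hn; lia.
  rewrite -/c -/K -/(W j n) -/(W j.+1 n) => H.
  have {}H : (c + K) * W j n <= K * W j.+1 n + N%:R * (M * (eta * (c + K) / (N%:R * M + 1))).
    apply: H => [k /andP[k1 k2]|k /andP[k1 k2]].
      by apply: hd; clear -hn k1 k2; lia.
    by apply: hf; clear -hn k1 k2; lia.
  have hh : N%:R * (M * (eta * (c + K) / (N%:R * M + 1))) <= eta * (c + K).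
    rewrite !mulrA ler_pdivrMr//.
    have : 0 <= eta * (c + K) by rewrite ltW// mulr_gt0.
    lra.
  rewrite -(ler_pM2l cK0); apply: (le_trans H).
  rewrite (_ : (c + K) * (_ + _) = K * W j.+1 n + eta * (c + K)); first by rewrite lerD2l.
  by rewrite /t; field; rewrite gt_eqF.
(* [12 * (i + j) + 3] is the number of indices in the outermost window, where only [|d n k| <= M] is
   used. *)
have claim i : forall j eta, 0 < eta -> \forall n \near \oo,
    W j n <= t ^+ i * (M ^+ 2 * (12 * (i + j)%:R + 3)) + eta.
  elim: i => [j eta eta0|i IHi j eta eta0].
    apply: filterS2 (dM (6 * j + 2)%N) (nbhs_infty_ge (6 * j + 7)) => n /= hd hn.
    have : W j n <= \sum_(n - (6 * j + 1) <= k < n + (6 * j + 2)) M ^+ 2.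
      apply: ler_sum_nat => k /andP[k1 k2].
      rewrite -(real_normK (num_real (d n k))) ler_sqr ?nnegrE ?normr_ge0 ?(ltW M0)//.
      by apply: hd; clear -hn k1 k2; lia.
    rewrite sumr_const_nat -[_ ^+ 2 *+ _]mulr_natr.
    have -> : (n + (6 * j + 2) - (n - (6 * j + 1)) = 12 * j + 3)%N by clear -hn; lia.
    rewrite expr0 mul1r add0n natrD natrM; lra.
  have e2 : 0 < eta / 2 by lra.
  apply: filterS2 (IHi j.+1 _ e2) (step j _ e2) => n.
  rewrite addnS addSn => h1 h2; apply: (le_trans h2).
  case/andP: t01 => t0 t1.
  have := ler_wpM2l (ltW t0) h1; rewrite (mulrDr t) (mulrA t (t ^+ i)) -exprS => h3.
  have : t * (eta / 2) <= eta / 2 by rewrite -[leRHS]mul1r ler_wpM2r ?ltW.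
  lra.
move=> eta eta0; have e2 : 0 < eta / 2 by lra.
have [i hi] := geometric_beats_linear t01 (sqr_ge0 M) e2.
apply: filterS (claim i 0%N _ e2) => n; rewrite addn0 /W muln0 !add0n.
lra.
Qed.

End EnergyDecay.

(** * Asymptotics of positive solutions of the Freud equations *)

Section FreudAsymptotics.
Context {R : realType}.

Lemma freud_sumZ (s : R) y m :
  freud_sum (fun k => y k * s) m = freud_sum y m * s ^+ 4.
Proof. by rewrite /freud_sum /phi0 /phi1 /phi2 /phi3; ring. Qed.

Lemma le_freud_sum (y : nat -> R) m : (forall k, (m <= k)%N -> 0 <= y k) ->
  y m.+3 ^+ 4 <= freud_sum y m.
Proof.
move=> y0.
have := y0 m (leqnn _); have := y0 m.+1 (leqW (leqnn _)).
have : forall k, 0 <= y (m + k)%N by move=> k; apply: y0; exact: leq_addr.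
move=> y0'; have := y0' 2%N; have := y0' 3%N; have := y0' 4%N; have := y0' 5%N; have := y0' 6%N.
rewrite !addnS addn0 /freud_sum; move: (y m) (y m.+1) (y m.+2) (y m.+3) (y m.+4) (y m.+4.+1) (y m.+4.+2).
move=> a b c e f g h h0 g0 f0 e0 c0 b0 a0.
have p0 : 0 <= phi0 e f g h - e ^+ 4.
  rewrite (_ : _ - _ = 3 * e ^+ 3 * f + e * f ^+ 3
    + 3 * e ^+ 2 * f ^+ 2 + 2 * e ^+ 2 * f * g + 2 * e * f ^+ 2 * g
    + e * f * g ^+ 2 + e * f * g * h); last by rewrite /phi0; ring.
  by rewrite !addr_ge0// !mulr_ge0// ?exprn_ge0.
have p1 : 0 <= phi1 c e f g by rewrite /phi1 !addr_ge0// !mulr_ge0// ?exprn_ge0.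
have p2 : 0 <= phi2 b c e f by rewrite /phi2 !addr_ge0// !mulr_ge0// ?exprn_ge0.
have p3 : 0 <= phi3 a b c e by rewrite /phi3 !mulr_ge0.
lra.
Qed.

(** Every monomial contains the factor [y m.+3]; thus an upper bound on the neighbours turns a lower
    bound on the sum into one on [y m.+3]. *)
Lemma freud_sum_le (U : R) (y : nat -> R) m :
  (forall k, (m <= k <= m + 6)%N -> 0 <= y k <= U) ->
  freud_sum y m <= 35 * U ^+ 3 * y m.+3.
Proof.
move=> yU; have yU' k : (k <= 6)%N -> 0 <= y (m + k)%N <= U by move=> k6; apply: yU; lia.
have cube p q r : 0 <= p <= U -> 0 <= q <= U -> 0 <= r <= U -> p * q * r <= U ^+ 3.
  move=> /andP[p0 pU] /andP[q0 qU] /andP[r0 rU].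
  by rewrite !exprSr expr0 mul1r !ler_pM// mulr_ge0.
have := yU' 0%N isT; have := yU' 1%N isT; have := yU' 2%N isT; have := yU' 3%N isT.
have := yU' 4%N isT; have := yU' 5%N isT; have := yU' 6%N isT.
rewrite !addnS addn0 /freud_sum; move: (y m) (y m.+1) (y m.+2) (y m.+3) (y m.+4) (y m.+4.+1) (y m.+4.+2).
move=> a b c e f g h hh hg hf he hc hb ha; have e0 : 0 <= e by case/andP: he.
have p0 : phi0 e f g h <= 14 * U ^+ 3 * e.
  rewrite (_ : phi0 _ _ _ _ = (e * e * e + 3 * (e * e * f) + f * f * f + 3 * (e * f * f)
    + 2 * (e * f * g) + 2 * (f * f * g) + f * g * g + f * g * h) * e); last by rewrite /phi0; ring.
  rewrite ler_wpM2r//.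
  have := cube e e e he he he; have := cube e e f he he hf; have := cube f f f hf hf hf.
  have := cube e f f he hf hf; have := cube e f g he hf hg; have := cube f f g hf hf hg.
  have := cube f g g hf hg hg; have := cube f g h hf hg hh; lra.
have p1 : phi1 c e f g <= 14 * U ^+ 3 * e.
  rewrite (_ : phi1 _ _ _ _ = (c * c * c + 3 * (c * e * e) + 3 * (c * c * e) + c * c * f
    + 4 * (c * e * f) + c * f * f + c * f * g) * e); last by rewrite /phi1; ring.
  rewrite ler_wpM2r//.
  have := cube c c c hc hc hc; have := cube c e e hc he he; have := cube c c e hc hc he.
  have := cube c c f hc hc hf; have := cube c e f hc he hf; have := cube c f f hc hf hf.
  have := cube c f g hc hf hg; lra.
have p2 : phi2 b c e f <= 6 * U ^+ 3 * e.
  rewrite (_ : phi2 _ _ _ _ = (b * b * c + 2 * (b * c * c) + 2 * (b * c * e) + b * c * f) * e);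
    last by rewrite /phi2; ring.
  rewrite ler_wpM2r//.
  have := cube b b c hb hb hc; have := cube b c c hb hc hc; have := cube b c e hb hc he.
  have := cube b c f hb hc hf; lra.
have p3 : phi3 a b c e <= U ^+ 3 * e by rewrite /phi3 ler_wpM2r ?cube.
lra.
Qed.

Lemma freud_equation_asymptotics (c : R) (g : nat -> R) : 0 < c ->
  (forall n, (0 < n)%N -> 0 < g n) ->
  (forall m, freud_sum g m = (m.+3 + odd m.+3)%:R * c) ->
  forall e, 0 < e -> \forall n \near \oo, forall k, (n - 1 <= k < n + 2)%N ->
    `|ln (g k) - ln (n%:R * c / 35) / 4| <= e.
Proof.
move=> c0 g0 gE.
(* [L n] is the logarithm of the constant solution of [35 y^4 = n c]. *)
pose L n := ln (n%:R * c / 35) / 4.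
pose d n k := ln (g k) - L n.
(* Near [n] the rescaled Freud sums lie between [35 / 2] and 70, as [k + odd k] lies between [n / 2]
   and [2 n]. This gives [y <= 70] and then [y >= 1 / (2 U^3)]. *)
pose U : R := 70; pose M : R := ln (2 * U ^+ 3).
have UM : 1 < 2 * U ^+ 3 :> R by rewrite -[1]mul1r ltr_pM// ?exprn_egt1// /U; lra.
have M0 : 0 < M by rewrite ln_gt0.
have expd n k : (0 < k)%N -> expR (d n k) = g k * expR (- L n).
  by move=> k0; rewrite /d expRD lnK// posrE g0.
have expL n : (0 < n)%N -> expR (- L n) ^+ 4 = 35 / (n%:R * c).
  move=> n0; have q0 : 0 < n%:R * c / 35 by rewrite divr_gt0// mulr_gt0// ltr0n.
  by rewrite -expRM_natl mulrN /L mulrC divfK// expRN lnK ?posrE// invf_div.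
(* Index 0 is excluded because [g 0] is not assumed positive, so [expR (d n 0)] need not be the
   rescaled [g 0]. *)
have fE n m : (0 < n)%N -> (0 < m)%N ->
    freud_sum (fun k => expR (d n k)) m = 35 * (m.+3 + odd m.+3)%:R / n%:R.
  move=> n0 m0.
  rewrite (_ : freud_sum _ m = freud_sum (fun k => g k * expR (- L n)) m); last first.
    by rewrite /freud_sum !expd.
  rewrite freud_sumZ gE expL//; field.
  by rewrite (gt_eqF c0) andbT pnatr_eq0 -lt0n.
have upper J : \forall n \near \oo, forall k, (n <= k + J)%N -> (k <= n + J)%N ->
    expR (d n k) <= U.
  apply: filterS (nbhs_infty_ge (J + 10)%N) => n /= hn k k1 k2.
  have n0 : (0 < n)%N by lia.
  have [m km] : exists m, k = m.+3 by exists (k - 3)%N; lia.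
  have m0 : (0 < m)%N by lia.
  have h := le_freud_sum (y := fun k => expR (d n k)) (m := m) (fun _ _ => expR_ge0 _).
  rewrite fE// -km in h.
  have nR : 0 < n%:R :> R by rewrite ltr0n.
  have h70 : 35 * (k + odd k)%:R / n%:R <= 70 :> R.
    rewrite ler_pdivrMr// -!natrM ler_nat; case: (odd k) => /=; lia.
  case: (lerP (expR (d n k)) 1) => e1; first by rewrite (le_trans e1)// /U; lra.
  rewrite (le_trans _ (le_trans h h70))//.
  by rewrite -[X in X <= _]expr1 ler_eXn2l.
have bound J : \forall n \near \oo, forall k, (n <= k + J)%N -> (k <= n + J)%N ->
    `|d n k| <= M.
  apply: filterS2 (upper (J + 3)%N) (nbhs_infty_ge (2 * J + 10)%N) => n /= hU hn k k1 k2.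
  have n0 : (0 < n)%N by lia.
  have [m km] : exists m, k = m.+3 by exists (k - 3)%N; lia.
  have m0 : (0 < m)%N by lia.
  have nR : 0 < n%:R :> R by rewrite ltr0n.
  have h1 : expR (d n k) <= U by apply: hU; lia.
  have h2 : 35 * (k + odd k)%:R / n%:R <= 35 * U ^+ 3 * expR (d n k).
    rewrite km -fE//; apply: freud_sum_le => j jm; rewrite expR_ge0 hU//; lia.
  have h3 : 35 / 2 <= 35 * (k + odd k)%:R / n%:R :> R.
    rewrite ler_pdivlMr// mulrAC ler_pdivrMr// -!natrM ler_nat.
    by case: (odd k) => /=; lia.
  have U0 : 0 < U ^+ 3 by rewrite exprn_gt0.
  have U1 : 1 <= U ^+ 3 by rewrite exprn_ege1// /U; lra.
  rewrite ler_norml; apply/andP; split.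
    rewrite -ler_expR expRN /M lnK ?posrE ?mulr_gt0//.
    rewrite -[X in X <= _]mul1r ler_pdivrMr ?mulr_gt0//.
    by have := le_trans h3 h2; lra.
  rewrite -ler_expR /M lnK ?posrE ?mulr_gt0// (le_trans h1)//.
  have : U * 1 <= U * U ^+ 2 by rewrite ler_wpM2l ?exprn_ege1// /U; lra.
  by rewrite -exprS; lra.
have err J eta : 0 < eta -> \forall n \near \oo,
    forall m, (n <= m + J)%N -> (m <= n + J)%N ->
    `|freud_sum (fun k => expR (d n k)) m - 35| <= eta.
  move=> eta0.
  (* The shift by 3 and the parity term add 4 to the distance [J]. *)
  apply: filterS2 (nbhs_infty_ge (2 * J + 10)%N) (nbhs_infty_ger (35 * (J + 4)%:R / eta)) => n /= hn hn' m m1 m2.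
  have n0 : (0 < n)%N by lia.
  have m0 : (0 < m)%N by lia.
  have nR : 0 < n%:R :> R by rewrite ltr0n.
  rewrite fE//.
  rewrite (_ : _ - _ = 35 * ((m.+3 + odd m.+3)%:R - n%:R) / n%:R); last first.
    by field; rewrite gt_eqF.
  rewrite normrM normfV (gtr0_norm nR) ler_pdivrMr// normrM ger0_norm//.
  apply: (@le_trans _ _ (35 * (J + 4)%:R)); last by rewrite [leRHS]mulrC -ler_pdivrMr.
  rewrite ler_pM2l// ler_norml lerNl opprB !lerBlDr -!natrD !ler_nat.
  by clear -hn m1 m2; case: (odd m.+3) => /=; lia.
move=> e e0; have e20 : 0 < e ^+ 2 by rewrite exprn_gt0.
apply: filterS (energy_vanishes M0 bound err e20) => n h k /andP[k1 k2].
rewrite -ler_sqr ?nnegrE ?normr_ge0 ?(ltW e0)// real_normK ?num_real//.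
apply: le_trans h.
have i1 : (k <= k.+1)%N by [].
apply: le_trans (le_energy (d n) k1 i1 k2).
by rewrite /energy big_nat1.
Qed.

End FreudAsymptotics.

(** * Orthogonality with respect to a linear functional *)

Section EvenOdd.
Context {R : comNzRingType}.
Implicit Types p q : {poly R}.

(** Multiply out [p = e(X^2) + X o(X^2)]. In the induction, a factor [X] exchanges even and odd
    parts. *)
Lemma even_odd_polyM p q :
  even_poly (p * q) = even_poly p * even_poly q + 'X * (odd_poly p * odd_poly q)
  /\ odd_poly (p * q) = even_poly p * odd_poly q + odd_poly p * even_poly q.
Proof.
elim/poly_ind: p => [|p c [IHe IHo]]; first by rewrite !mul0r !raddf0 !mul0r mulr0 !addr0.
rewrite mulrDl mulrAC !even_polyD !odd_polyD !even_polyMX !odd_polyMX IHe IHo.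
rewrite mul_polyC even_polyZ odd_polyZ even_polyC odd_polyC.
by rewrite -!mul_polyC; split; ring.
Qed.

Lemma even_poly_X2M p : even_poly ('X^2 * p) = 'X * even_poly p.
Proof.
rewrite mulrC exprS expr1 mulrA even_polyMX odd_polyMX mulrC//.
Qed.

(** Chain rule: with [Y = X^2], [X d/dX] becomes [2 Y d/dY]. *)
Lemma even_poly_Xderiv p : even_poly ('X * p^`()) = 2 *: ('X * (even_poly p)^`()).
Proof.
rewrite scaler_nat; apply/polyP => i; rewrite coefMn coef_even_poly !coefXM; case: i => [|i]/=.
  by rewrite mul0rn.
by rewrite !coef_deriv coef_even_poly -mulrnA muln2 doubleS.
Qed.

End EvenOdd.

Section Orthogonal.
Implicit Types n m : nat.
Context {R : fieldType} (F : {poly R} -> R) (Q : nat -> {poly R}).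
Context (FD : forall p q, F (p + q) = F p + F q).
Context (FZ : forall c p, F (c *: p) = c * F p).
Context (sizeQ : forall n, (size (Q n) <= n.+1)%N) (leadQ : forall n, (Q n)`_n = 1).
Context (orthQ : forall n m, (m < n)%N -> F (Q n * Q m) = 0).

Implicit Types p q r : {poly R}.

Lemma functional0 : F 0 = 0.
Proof. by rewrite -(scale0r 0) FZ mul0r. Qed.

Lemma functionalN p : F (- p) = - F p.
Proof. by rewrite -scaleN1r FZ mulN1r. Qed.

Lemma size_sub_lead n (p : {poly R}) : (size p <= n.+1)%N -> (size (p - p`_n *: Q n)%R <= n)%N.
Proof.
move=> sp; apply/leq_sizeP => j nj; rewrite coefB coefZ.
move: nj; rewrite leq_eqVlt => /predU1P[<-|nj]; first by rewrite leadQ mulr1 subrr.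
have h (r : {poly R}) : (size r <= n.+1)%N -> r`_j = 0.
  by move=> rn; rewrite nth_default// (leq_trans rn).
by rewrite !h ?mulr0 ?subr0.
Qed.

Lemma orth_small n q : (size q <= n)%N -> F (Q n * q) = 0.
Proof.
suff H k : forall q : {poly R}, (k <= n)%N -> (size q <= k)%N -> F (Q n * q) = 0 by move=> qn; apply: H qn.
elim: k => [|k IHk] {}q kn sq.
  by move: sq; rewrite leqn0 size_poly_eq0 => /eqP->; rewrite mulr0 functional0.
rewrite -(subrK (q`_k *: Q k) q) mulrDr FD IHk ?size_sub_lead//; last exact: ltnW.
by rewrite -scalerAr FZ orthQ// mulr0 addr0.
Qed.

Lemma orth_lead n q : (size q <= n.+1)%N -> F (Q n * q) = q`_n * F (Q n ^+ 2).
Proof.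
move=> sq; rewrite -[in LHS](subrK (q`_n *: Q n) q) mulrDr FD orth_small ?size_sub_lead//.
by rewrite add0r -scalerAr FZ expr2.
Qed.

End Orthogonal.

Section Positive.
Context {R : realFieldType} (u : {poly R} -> R) (P : nat -> {poly R}).
Context (uD : forall p q, u (p + q) = u p + u q).
Context (uZ : forall c p, u (c *: p) = c * u p).
Context (u_ge0 : forall p, (forall x, 0 <= x -> 0 <= p.[x]) -> 0 <= u p).
Context (sizeP : forall n, (size (P n) <= n.+1)%N) (leadP : forall n, (P n)`_n = 1).
Context (orthP : forall n m, (m < n)%N -> u (P n * P m) = 0).
Context (normP : forall n, u (P n ^+ 2) != 0).

Implicit Types p q : {poly R}.

(* The discriminant argument behind the Cauchy-Schwarz inequality. *)
Lemma isotropic_orth (w p q : {poly R}) : (forall x, 0 <= x -> 0 <= w.[x]) ->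
  u (w * p ^+ 2) = 0 -> u (w * (p * q)) = 0.
Proof.
move=> w0 wp0; set B := u (w * (p * q)).
have H t : 0 <= u (w * q ^+ 2) + t * (2 * B).
  have : 0 <= u (w * (q + t *: p) ^+ 2).
    by apply: u_ge0 => x x0; rewrite hornerM horner_exp mulr_ge0 ?sqr_ge0 ?w0.
  have -> : w * (q + t *: p) ^+ 2 =
      w * q ^+ 2 + ((t * 2) *: (w * (p * q)) + t ^+ 2 *: (w * p ^+ 2)).
    by rewrite -!mul_polyC expr2 !polyCM; ring.
  by rewrite !uD !uZ wp0 mulr0 addr0 -mulrA.
apply/eqP; case: eqP => // /eqP B0.
have := H (- (u (w * q ^+ 2) + 1) / (2 * B)).
by rewrite divfK ?mulf_neq0 ?pnatr_eq0//; lra.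
Qed.

(** Strictness is algebraic: an isotropic [p] of degree [n] would be orthogonal to [P n], but that
    pairing is the leading coefficient times a nonzero norm. *)
Lemma functional_sqr_gt0 p : p != 0 -> 0 < u (p ^+ 2).
Proof.
move=> p0; rewrite lt_def u_ge0 ?andbT; last by move=> x _; rewrite horner_exp sqr_ge0.
apply: contra_neq p0 => up.
have [/eqP|sp] := posnP (size p); first by rewrite size_poly_eq0 => /eqP.
pose n := (size p).-1.
have sn : (size p <= n.+1)%N by rewrite /n prednK.
have up1 : u (1 * p ^+ 2) = 0 by rewrite mul1r.
have w1 x : 0 <= x -> 0 <= (1 : {poly R}).[x] by rewrite hornerC.
have := isotropic_orth (P n) w1 up1.
rewrite mul1r mulrC (orth_lead uD uZ sizeP leadP orthP sn) => /eqP.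
by rewrite mulf_eq0 (negPf (normP n)) orbF -/(lead_coef p) lead_coef_eq0 => /eqP.
Qed.

(** With weight [X], testing an isotropic [p] against [X * p] produces the square of [X * p]. *)
Lemma functional_Xsqr_gt0 p : p != 0 -> 0 < u ('X * p ^+ 2).
Proof.
move=> p0.
have X0 x : 0 <= x -> 0 <= ('X : {poly R}).[x] by rewrite hornerX.
rewrite lt_def u_ge0 ?andbT; last first.
  by move=> x x0; rewrite hornerM horner_exp hornerX mulr_ge0 ?sqr_ge0.
apply/eqP => up.
have := isotropic_orth ('X * p) X0 up.
have -> : 'X * (p * ('X * p)) = ('X * p) ^+ 2 by ring.
move=> h; have : 'X * p != 0 by rewrite mulf_neq0// polyX_eq0.
by move/functional_sqr_gt0; rewrite h ltxx.
Qed.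

End Positive.

(** * Orthogonal polynomials of a symmetric functional *)

(** Solving each relation for its newest element leaves a ring identity in [X], [f0], [s0] and the
    [g]'s. The [f]'s and [s]'s stand for polynomials of opposite parity. *)
Lemma recurrence_powers (A : comNzRingType)
    (X f0 s0 f1 s2 f2 s4 f3 s6 f4 g0 g1 g2 g3 g4 g5 g6 : A) :
  X * s0 = f1 + g0 * f0 -> X * f1 = s2 + g1 * s0 -> X * s2 = f2 + g2 * f1 ->
  X * f2 = s4 + g3 * s2 -> X * s4 = f3 + g4 * f2 -> X * f3 = s6 + g5 * s4 ->
  X * s6 = f4 + g6 * f3 ->
  X ^+ 3 * s2 = f3 + (g4 + g3 + g2) * f2
    + ((g3 + g2) * g2 + g2 * g1) * f1 + g2 * g1 * g0 * f0 /\
  X ^+ 4 * f2 = f4 + (g6 + g5 + g4 + g3) * f3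
    + ((g5 + g4 + g3) * g4 + (g4 + g3) * g3 + g3 * g2) * f2
    + (((g4 + g3) * g3 + g3 * g2) * g2 + g3 * g2 * g1) * f1
    + g3 * g2 * g1 * g0 * f0.
Proof.
move=> r0 r1 r2 r3 r4 r5 r6.
have q0 : f1 = X * s0 - g0 * f0 by rewrite r0 addrK.
have q1 : s2 = X * f1 - g1 * s0 by rewrite r1 addrK.
have q2 : f2 = X * s2 - g2 * f1 by rewrite r2 addrK.
have q3 : s4 = X * f2 - g3 * s2 by rewrite r3 addrK.
have q4 : f3 = X * s4 - g4 * f2 by rewrite r4 addrK.
have q5 : s6 = X * f3 - g5 * s4 by rewrite r5 addrK.
have q6 : f4 = X * s6 - g6 * f3 by rewrite r6 addrK.
clear r0 r1 r2 r3 r4 r5 r6.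
by rewrite q6 q5 q4 q3 q2 q1 q0; split; ring.
Qed.

Section SymmetricOrthogonal.
Context {R : realType} (L : {poly R} -> R).
Implicit Types p q r : {poly R}.
Implicit Types m n : nat.

(** The pair holds [S_(n-1)] and [S_n], with [S_(-1) = 0]; the first quotient, by [L 0], multiplies
    the zero polynomial. *)
Fixpoint sop_pair n : {poly R} * {poly R} :=
  if n is m.+1 then
    ((sop_pair m).2, 'X * (sop_pair m).2
      - (L ((sop_pair m).2 ^+ 2) / L ((sop_pair m).1 ^+ 2)) *: (sop_pair m).1)
  else (0, 1).

Definition sop n := (sop_pair n).2.
Definition sop_norm n := L (sop n ^+ 2).
Definition sop_coef n := if n is m.+1 then sop_norm n / sop_norm m else 0.

Lemma sop_recurrence n : 'X * sop n = sop n.+1 + sop_coef n *: sop n.-1.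
Proof.
case: n => [|n]; last by rewrite /sop/= subrK.
by rewrite /sop/= scaler0 subr0 scale0r addr0.
Qed.

Lemma sop_parity n : (if odd n then even_poly (sop n) else odd_poly (sop n)) = 0.
Proof.
suff [] : (if odd n then even_poly (sop n) else odd_poly (sop n)) = 0 /\
  (if odd n.+1 then even_poly (sop n.+1) else odd_poly (sop n.+1)) = 0 by [].
elim: n => [|n [IH0 IH1]].
  rewrite /sop/= scaler0 subr0 mulr1 -[1]polyC1 odd_polyC.
  by rewrite -['X]mul1r even_polyMX -[1]polyC1 odd_polyC mul0r.
split=> //; have -> : sop n.+2 = sop n.+1 * 'X + (- sop_coef n.+1) *: sop n.
  by rewrite mulrC sop_recurrence scaleNr addrK.
move: IH0 IH1; rewrite /= negbK; case: (odd n) => /= h0 h1.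
  by rewrite even_polyD even_polyZ even_polyMX h0 h1 scaler0 mul0r addr0.
by rewrite odd_polyD odd_polyZ odd_polyMX h0 h1 scaler0 addr0.
Qed.

Lemma sop_size_lead n : (size (sop n) <= n.+1)%N /\ (sop n)`_n = 1.
Proof.
suff [] : ((size (sop n) <= n.+1)%N /\ (sop n)`_n = 1) /\
    ((size (sop n.+1) <= n.+2)%N /\ (sop n.+1)`_n.+1 = 1) by [].
elim: n => [|n [[IHs0 IHl0] [IHs IHl]]].
  rewrite /sop/= scaler0 subr0 mulr1 size_poly1 size_polyX coefX coef1.
  by rewrite !eqxx.
split=> //; have -> : sop n.+2 = 'X * sop n.+1 - sop_coef n.+1 *: sop n.
  by rewrite sop_recurrence addrK.
have big j : (n.+1 <= j)%N -> (sop n)`_j = 0 by move/leq_sizeP: IHs0; apply.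
split; last by rewrite coefB coefZ coefXM/= IHl big ?mulr0 ?subr0.
apply/leq_sizeP => -[//|j] jn; rewrite coefB coefZ coefXM/= big; last by lia.
by move/leq_sizeP: IHs => ->//; rewrite mulr0 subr0.
Qed.

Lemma sop_neq0 n : sop n != 0.
Proof.
by apply/eqP => h; have [_] := sop_size_lead n; rewrite h coef0 => /eqP; rewrite eq_sym oner_eq0.
Qed.

Context (LD : forall p q, L (p + q) = L p + L q).
Context (LZ : forall c p, L (c *: p) = c * L p).
Context (L_gt0 : forall p, p != 0 -> 0 < L (p ^+ 2)).
Context (L_odd : forall p, even_poly p = 0 -> L p = 0).

Lemma sop_norm_gt0 n : 0 < sop_norm n.
Proof. exact/L_gt0/sop_neq0. Qed.

Lemma sop_coef_gt0 n : (0 < n)%N -> 0 < sop_coef n.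
Proof. by case: n => // n _; rewrite divr_gt0// sop_norm_gt0. Qed.

Lemma sop_coef_norm n : sop_coef n.+1 * sop_norm n = sop_norm n.+1.
Proof. by rewrite /= divfK// gt_eqF// sop_norm_gt0. Qed.

(* Stated with a spare factor so that it also holds at [n = 0], where [sop_coef 0 = 0]. *)
Lemma sop_coef2_norm n :
  sop_coef n * (sop_coef n * sop_norm n.-1) = sop_coef n * sop_norm n.
Proof. by case: n => [|n]; rewrite ?mul0r// sop_coef_norm. Qed.

(** The recurrence moves a factor [X] from one polynomial to the other. Adjacent indices are settled
    by parity, distance two by the choice of [sop_coef] as a ratio of norms. *)
Lemma sop_orth_lt n m : (m < n)%N -> L (sop n * sop m) = 0.
Proof.
elim/ltn_ind: n m => -[//|n] IH m; rewrite ltnS leq_eqVlt => /predU1P[->|mn].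
  apply: L_odd; have [-> _] := even_odd_polyM (sop n.+1) (sop n).
  have := sop_parity n; have := sop_parity n.+1; rewrite /=.
  by case: (odd n) => /= -> ->; rewrite ?mul0r ?mulr0 ?addr0.
have -> : sop n.+1 * sop m = sop n * sop m.+1 + sop_coef m *: (sop n * sop m.-1)
    + (- sop_coef n) *: (sop n.-1 * sop m).
  have -> : sop n.+1 = 'X * sop n - sop_coef n *: sop n.-1 by rewrite sop_recurrence addrK.
  rewrite mulrBl mulrAC (sop_recurrence m) mulrDl -!scalerAl scaleNr.
  by rewrite [sop m.+1 * _]mulrC [sop m.-1 * _]mulrC.
rewrite !LD !LZ [X in _ + _ * X + _]IH ?mulr0 ?addr0//; last by lia.
move: mn; rewrite leq_eqVlt => /predU1P[nE|mn].
  rewrite -nE [m.+1.-1]/= -!expr2 -/(sop_norm m.+1) -/(sop_norm m).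
  by rewrite mulNr sop_coef_norm subrr.
rewrite !IH ?mulr0 ?addr0//; lia.
Qed.

Lemma sop_orth n m : L (sop n * sop m) = if n == m then sop_norm n else 0.
Proof.
case: ltngtP => nm; last by rewrite nm -expr2.
- by rewrite mulrC sop_orth_lt.
- exact: sop_orth_lt.
Qed.

(* Only the coefficients of [S_(m-1), S_(m+1), S_(m+3), S_(m+5)] in
   [X^3 S_(m+2)] and [X^4 S_(m+3)] matter; for [m = 0] the first one carries the
   factor [sop_coef 0 = 0]. *)
Lemma sop_path_sum m :
  L ('X^7 * (sop m.+2 * sop m.+3)) = sop_norm m.+2 * freud_sum sop_coef m.
Proof.
pose g i := sop_coef (m + i); pose f i := sop (m + i.*2).-1.
have orth i j : L (f i * f j) = if i == j then sop_norm (m + i.*2).-1 else 0.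
  rewrite sop_orth; congr (if _ then _ else _).
  by apply/eqP/eqP => [|-> //]; lia.
have R0 : 'X * sop m = f 1 + (g 0)%:P * f 0.
  by rewrite mul_polyC /f /g !addnS !addn0 sop_recurrence.
have R1 : 'X * f 1 = sop m.+2 + (g 1)%:P * sop m.
  by rewrite mul_polyC /f /g !addnS !addn0 sop_recurrence.
have R2 : 'X * sop m.+2 = f 2 + (g 2)%:P * f 1.
  by rewrite mul_polyC /f /g !addnS !addn0 sop_recurrence.
have R3 : 'X * f 2 = sop m.+4 + (g 3)%:P * sop m.+2.
  by rewrite mul_polyC /f /g !addnS !addn0 sop_recurrence.
have R4 : 'X * sop m.+4 = f 3 + (g 4)%:P * f 2.
  by rewrite mul_polyC /f /g !addnS !addn0 sop_recurrence.
have R5 : 'X * f 3 = sop m.+4.+2 + (g 5)%:P * sop m.+4.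
  by rewrite mul_polyC /f /g !addnS !addn0 sop_recurrence.
have R6 : 'X * sop m.+4.+2 = f 4 + (g 6)%:P * f 3.
  by rewrite mul_polyC /f /g !addnS !addn0 sop_recurrence.
have [E3 E4] := recurrence_powers R0 R1 R2 R3 R4 R5 R6.
have -> : 'X^7 * (sop m.+2 * sop m.+3) = ('X^3 * sop m.+2) * ('X^4 * f 2).
  by rewrite /f !addnS addn0 [RHS]mulrACA -exprD.
have bilin (a2 a1 a0 b3 b2 b1 b0 : R) :
    L ((f 3 + a2 *: f 2 + a1 *: f 1 + a0 *: f 0)
       * (f 4 + b3 *: f 3 + b2 *: f 2 + b1 *: f 1 + b0 *: f 0)) =
    b3 * sop_norm m.+4.+1 + a2 * b2 * sop_norm m.+3 + a1 * b1 * sop_norm m.+1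
      + a0 * b0 * sop_norm m.-1.
  set rhs := RHS; rewrite !mulrDl !mulrDr -!scalerAl -!scalerAr !LD !LZ !orth /=.
  by rewrite !mulr0 !addr0 !add0r !addnS addn0 /= !mulrA.
rewrite {}E3 {}E4 -!(polyCD, polyCM) !mul_polyC bilin.
have n1 : sop_norm m.+1 = g 1 * sop_norm m by rewrite /g addn1 sop_coef_norm.
have n2 : sop_norm m.+2 = g 2 * (g 1 * sop_norm m) by rewrite -n1 /g addn2 sop_coef_norm.
have n3 : sop_norm m.+3 = g 3 * (g 2 * (g 1 * sop_norm m)).
  by rewrite -n2 /g addn3 sop_coef_norm.
have n4 : sop_norm m.+4 = g 4 * (g 3 * (g 2 * (g 1 * sop_norm m))).
  by rewrite -n3 /g addn4 sop_coef_norm.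
have n5 : sop_norm m.+4.+1 = g 5 * (g 4 * (g 3 * (g 2 * (g 1 * sop_norm m)))).
  by rewrite -n4 /g !addnS addn0 sop_coef_norm.
have n0 : g 0 * (g 0 * sop_norm m.-1) = g 0 * sop_norm m by rewrite /g addn0 sop_coef2_norm.
have -> : freud_sum sop_coef m = phi0 (g 3) (g 4) (g 5) (g 6) + phi1 (g 2) (g 3) (g 4) (g 5)
    + phi2 (g 1) (g 2) (g 3) (g 4) + phi3 (g 0) (g 1) (g 2) (g 3).
  by rewrite /g !addnS !addn0.
have -> : g 2 * g 1 * g 0 * (g 3 * g 2 * g 1 * g 0) * sop_norm m.-1 =
    g 2 * g 1 * (g 3 * g 2 * g 1) * (g 0 * sop_norm m) by rewrite -n0; ring.
rewrite n5 n3 n2 n1 /phi0 /phi1 /phi2 /phi3; ring.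
Qed.

End SymmetricOrthogonal.

(** * Symmetrization *)

(** If [u] integrates against [w] on the half-line, this integrates against [|t| w(t^2)] on the
    whole line. *)
Definition symmetrized (R : realType) (u : {poly R} -> R) (p : {poly R}) :=
  u (even_poly p).

Section Symmetrization.
Context {R : realType} (u : {poly R} -> R).
Context (uD : forall p q, u (p + q) = u p + u q).
Context (uZ : forall c p, u (c *: p) = c * u p).
Context (u_sqr_gt0 : forall p, p != 0 -> 0 < u (p ^+ 2)).
Context (u_Xsqr_gt0 : forall p, p != 0 -> 0 < u ('X * p ^+ 2)).
Implicit Types p q r : {poly R}.
Local Notation L := (symmetrized u).

Lemma symmetrizedD p q : L (p + q) = L p + L q.
Proof. by rewrite /symmetrized even_polyD uD. Qed.

Lemma symmetrizedZ c p : L (c *: p) = c * L p.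
Proof. by rewrite /symmetrized even_polyZ uZ. Qed.

Lemma symmetrized_odd p : even_poly p = 0 -> L p = 0.
Proof. by rewrite /symmetrized => ->; exact: functional0. Qed.

(** The even part of [p^2] is [e^2 + X o^2], with [e] and [o] the even and odd parts of [p]. *)
Lemma symmetrized_gt0 p : p != 0 -> 0 < L (p ^+ 2).
Proof.
move=> p0; rewrite /symmetrized expr2; have [-> _] := even_odd_polyM p p.
rewrite -!expr2 uD.
case: (eqVneq (even_poly p) 0) => e0; case: (eqVneq (odd_poly p) 0) => o0.
- by move: p0; rewrite -(poly_even_odd p) e0 o0 comp_poly0 mul0r addr0 eqxx.
- by rewrite e0 expr0n (functional0 uZ) add0r u_Xsqr_gt0.
- by rewrite o0 expr0n mulr0 (functional0 uZ) addr0 u_sqr_gt0.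
- by rewrite addr_gt0 ?u_sqr_gt0 ?u_Xsqr_gt0.
Qed.

Context (c : R) (c0 : 0 < c).
Context (pearson : forall k, u (c *: 'X^(k.+4) - k.+1%:R *: 'X^k) = 0).

(** By linearity it suffices to take [q = X^i], where [q + X q' = (i + 1) X^i]. *)
Lemma pearson_poly q : c * u ('X^4 * q) = u (q + 'X * q^`()).
Proof.
pose G q := u (c *: ('X^4 * q) - (q + 'X * q^`())).
have GD (p r : {poly R}) : G (p + r) = G p + G r.
  rewrite /G -uD; congr u; rewrite derivD -!mul_polyC; ring.
have GZ (d : R) (p : {poly R}) : G (d *: p) = d * G p.
  by rewrite /G -uZ; congr u; rewrite derivZ -!mul_polyC; ring.
suff : G q = 0.
  move=> E; apply/eqP; rewrite -subr_eq0 -uZ -(functionalN uZ) -uD.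
  by apply/eqP; exact: E.
rewrite -[q]coefK poly_def; elim/big_ind: _ => [|p r hp hr|i _].
- by rewrite -(scale0r 0) GZ mul0r.
- by rewrite GD hp hr addr0.
- rewrite GZ; suff -> : G 'X^i = 0 by rewrite mulr0.
  rewrite /G -exprD derivXn (_ : 'X^i + _ = i.+1%:R *: 'X^i) ?pearson// mulrnAr.
  by case: (val i) => [|j] /=; rewrite ?mulr0n ?addr0 ?scale1r// -exprS -mulrS scaler_nat.
Qed.

(** This is integration by parts of [p(t) t |t| exp(- z t^8)] when [c = 4 z]; the 2 is the degree of
    [t |t|]. *)
Lemma symmetrized_pearson p : (2 * c) * L ('X^8 * p) = L ('X * p^`()) + 2 * L p.
Proof.
rewrite /symmetrized even_poly_Xderiv uZ.
have -> : 'X^8 * p = 'X^2 * ('X^2 * ('X^2 * ('X^2 * p))) by ring.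
rewrite !even_poly_X2M.
have -> : 'X * ('X * ('X * ('X * even_poly p))) = 'X^4 * even_poly p by ring.
by rewrite -mulrA pearson_poly uD mulrDr addrC.
Qed.

Local Notation S := (sop L).
Local Notation h := (sop_norm L).
Local Notation g := (sop_coef L).
Let A n := L ('X^7 * (S n * S n.+1)) / h n.

Let h0 n : 0 < h n. Proof. exact: (sop_norm_gt0 symmetrized_gt0). Qed.
Let sizeS n : (size (S n) <= n.+1)%N := (sop_size_lead L n).1.
Let leadS n : (S n)`_n = 1 := (sop_size_lead L n).2.
Let orthS n m : (m < n)%N -> L (S n * S m) = 0.
Proof. exact: (sop_orth_lt symmetrizedD symmetrizedZ symmetrized_gt0 symmetrized_odd). Qed.

(* Both sides compute [L (X^8 S_n^2)], the left one by the recurrence, the right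
   one by integration by parts; the equations for single [A n] then follow by
   alternating summation. *)
Lemma freud_step n : (2 * c) * (A n + (if n is m.+1 then A m else 0)) = 2 * n.+1%:R.
Proof.
apply: (mulIf (lt0r_neq0 (h0 n))).
have L8 : L ('X^8 * S n ^+ 2) = (A n + (if n is m.+1 then A m else 0)) * h n.
  have -> : 'X^8 * S n ^+ 2 = 'X^7 * (S n * S n.+1) + g n *: ('X^7 * (S n.-1 * S n)).
    rewrite (_ : 'X^8 * _ = 'X^7 * (S n * ('X * S n))); last by ring.
    by rewrite sop_recurrence -!mul_polyC; ring.
  rewrite symmetrizedD symmetrizedZ mulrDl; congr (_ + _); first by rewrite /A divfK ?gt_eqF.
  case: n => [|n]; first by rewrite !mul0r.
  by rewrite /A /=; field; rewrite gt_eqF.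
rewrite -(mulrA (2 * c)) -L8 symmetrized_pearson -/(h n).
have -> : 'X * (S n ^+ 2)^`() = 2 *: (S n * ('X * (S n)^`())).
  by rewrite expr2 derivM -!mul_polyC; ring.
have sX : (size ('X * (S n)^`())%R <= n.+1)%N.
  apply/leq_sizeP => -[//|j] jn; rewrite coefXM/= coef_deriv nth_default ?mul0rn//.
  by rewrite (leq_trans (sizeS n)).
rewrite symmetrizedZ (orth_lead symmetrizedD symmetrizedZ sizeS leadS orthS sX) -/(h n).
rewrite (_ : ('X * _)`_n = n%:R); first by rewrite -natr1; ring.
by rewrite coefXM; case: (n) => [//|m] /=; rewrite coef_deriv leadS.
Qed.

(** The parity term survives the alternating summation, since
    [2 k - (k - 1 + odd (k - 1)) = k + odd k]. [sop_path_sum] identifies [A m.+2] with the Freud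
    sum. *)
Lemma freud_equation m : freud_sum g m = (m.+3 + odd m.+3)%:R * (2 * c)^-1.
Proof.
have H n : (2 * c) * A n = (n.+1 + odd n.+1)%:R.
  elim: n => [|n IH]; first by have := freud_step 0; rewrite addr0 mulr1.
  have := freud_step n.+1; rewrite mulrDr IH => E.
  have -> : (2 * c) * A n.+1 = 2 * n.+2%:R - (n.+1 + odd n.+1)%:R by rewrite -E addrK.
  by rewrite !natrD -!natr1 /=; case: (odd n) => /=; ring.
have := H m.+2.
rewrite /A (sop_path_sum symmetrizedD symmetrizedZ symmetrized_gt0 symmetrized_odd).
rewrite (mulrC (h m.+2)) mulfK ?lt0r_neq0// => <-.
by rewrite [RHS]mulrC mulKf// lt0r_neq0// mulr_gt0.
Qed.

Context (P : nat -> {poly R}) (a b : nat -> R).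
Context (sizeP : forall n, (size (P n) <= n.+1)%N) (leadP : forall n, (P n)`_n = 1).
Context (orthP : forall n m, (m < n)%N -> u (P n * P m) = 0).
Context (rec : forall n, 'X * P n =
    P n.+1 + b n *: P n + (if n is m.+1 then a n *: P m else 0)).

(** Uniqueness of monic orthogonal polynomials: the difference has lower degree, hence is orthogonal
    to both and so to itself. *)
Lemma even_poly_sop n : even_poly (S n.*2) = P n.
Proof.
pose T n := even_poly (S n.*2).
have sizeT k : (size (T k) <= k.+1)%N.
  apply: leq_trans (size_even_poly _) _; rewrite leq_uphalf_double.
  by apply: leq_trans (sizeS _) _; rewrite doubleS.
have leadT k : (T k)`_k = 1 by rewrite coef_even_poly leadS.
have orthT k m : (m < k)%N -> u (T k * T m) = 0.
  move=> mk; rewrite -(orthS (n := k.*2) (m := m.*2)) ?ltn_double// /symmetrized.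
  have [-> _] := even_odd_polyM (S k.*2) (S m.*2).
  by have := sop_parity L k.*2; rewrite odd_double => ->; rewrite mul0r mulr0 addr0.
apply/eqP; rewrite -subr_eq0; apply/negPn/negP => /u_sqr_gt0.
have D : (size (T n - P n)%R <= n)%N.
  by have := size_sub_lead sizeP leadP (sizeT n); rewrite leadT scale1r.
rewrite -/(T n) expr2 mulrBl uD (functionalN uZ).
by rewrite (orth_small uD uZ sizeP leadP orthP D) (orth_small uD uZ sizeT leadT orthT D) subrr ltxx.
Qed.

(** Applying the symmetric recurrence twice gives a three-term relation for the [P n]; comparing
    coefficients of degree [n + 1] and [n] identifies it with [rec]. *)
Lemma recurrence_coefficients n :
  a n.+1 = g n.*2.+2 * g n.*2.+1 /\ b n.+1 = g n.*2.+3 + g n.*2.+2.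
Proof.
have X2 : 'X^2 * S n.*2.+2 = S n.*2.+4 + (g n.*2.+3 + g n.*2.+2) *: S n.*2.+2
    + (g n.*2.+2 * g n.*2.+1) *: S n.*2.
  rewrite expr2 -mulrA sop_recurrence mulrDr -scalerAr !sop_recurrence.
  by rewrite -!mul_polyC; ring.
have : 'X * P n.+1 = P n.+2 + (g n.*2.+3 + g n.*2.+2) *: P n.+1
    + (g n.*2.+2 * g n.*2.+1) *: P n.
  rewrite -!even_poly_sop -even_poly_X2M doubleS X2 doubleS.
  by rewrite -!even_polyZ -!even_polyD.
rewrite rec.
rewrite -!addrA => /addrI /eqP; rewrite -subr_eq0 => /eqP E.
have E1 := congr1 (fun p : {poly R} => p`_n.+1) E.
have E0 := congr1 (fun p : {poly R} => p`_n) E.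
have Pn1 : (P n)`_n.+1 = 0 by rewrite nth_default.
move: E1 E0; rewrite /= !(coefB, coefD, coefZ, coef0) !leadP Pn1 !mulr1 !mulr0 !addr0.
move=> /eqP; rewrite subr_eq0 => /eqP bE; rewrite bE.
by rewrite opprD addrACA subrr add0r => /eqP; rewrite subr_eq0 => /eqP aE.
Qed.

End Symmetrization.

(** * Asymptotic equivalence of sequences *)

Section Limits.

Lemma log_asymp_equiv (R : realType) (f g : nat -> R) :
  (\forall n \near \oo, 0 < f n /\ 0 < g n) ->
  (forall e : R, 0 < e -> \forall n \near \oo, `|ln (f n) - ln (g n)| <= e) ->
  asymp_equiv f g.
Proof.
move=> fg0 fg.
have lim : ln (f n) - ln (g n) @[n --> \oo] --> (0 : R).
  apply/cvgrPdist_le => e e0; apply: filterS (fg e e0) => n.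
  by rewrite sub0r normrN.
have := cvg_comp _ _ lim (@continuous_expR R 0).
rewrite expR0 /asymp_equiv; apply: cvg_trans; apply: near_eq_cvg.
by apply: filterS fg0 => n [f0 g0] /=; rewrite expRB !lnK ?posrE.
Qed.

Lemma asymp_equivM (R : realType) (f g f' g' : nat -> R) :
  asymp_equiv f g -> asymp_equiv f' g' ->
  asymp_equiv (fun n => f n * f' n) (fun n => g n * g' n).
Proof.
move=> h h'.
have : (fun n => f n / g n * (f' n / g' n)) @ \oo --> (1 * 1 : R) by exact: cvgM.
rewrite mulr1; apply: cvg_trans.
by apply: near_eq_cvg; apply: nearW => n /=; rewrite mulf_div.
Qed.

Lemma asymp_equivD (R : realType) (f f' g : nat -> R) :
  asymp_equiv f g -> asymp_equiv f' g ->
  asymp_equiv (fun n => f n + f' n) (fun n => 2 * g n).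
Proof.
move=> h h'.
have : (fun n => 2^-1 * (f n / g n + f' n / g n)) @ \oo --> (2^-1 * (1 + 1) : R).
  by apply: cvgM; [exact: cvg_cst|exact: cvgD].
rewrite (_ : 2^-1 * (1 + 1) = 1); last by field.
apply: cvg_trans; apply: near_eq_cvg; apply: nearW => n /=.
by rewrite invfM mulrCA -mulrDl.
Qed.

Lemma asymp_equiv_near (R : realType) (f f' g g' : nat -> R) :
  (\forall n \near \oo, f n = f' n /\ g n = g' n) ->
  asymp_equiv f g -> asymp_equiv f' g'.
Proof.
move=> E; apply: cvg_trans; apply: near_eq_cvg.
by apply: filterS E => n [-> ->].
Qed.

End Limits.

Local Close Scope classical_set_scope.

Theorem mainTheorem4 (R : realType) (z : R) (P : nat -> {poly R})
    (a b : nat -> R) :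
  0 < z ->
  monic_orthogonal (freud_functional z) P ->
  three_term_recurrence P a b ->
  asymp_equiv a (fun n => Num.sqrt (n%:R / (140 * z))) /\
  asymp_equiv b (fun n => 2 * (n%:R / (140 * z)) `^ (4^-1)).
Proof.
move=> z0 [Pmonic sizeP orthP normP] rec.
pose u := freud_functional z.
have uD p q : u (p + q) = u p + u q := freud_functionalD _ _ z0.
have uZ d p : u (d *: p) = d * u p := freud_functionalZ _ _ z0.
have u_ge0 p : (forall x, 0 <= x -> 0 <= p.[x]) -> 0 <= u p := @freud_functional_ge0 _ z p.
have sizeP' n : (size (P n) <= n.+1)%N by rewrite sizeP.
have leadP n : (P n)`_n = 1 by have := Pmonic n; rewrite monicE /lead_coef sizeP => /eqP.
have orthP' n m : (m < n)%N -> u (P n * P m) = 0.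
  by move=> mn; apply: orthP => nm; rewrite nm ltnn in mn.
have pos := functional_sqr_gt0 uD uZ u_ge0 sizeP' leadP orthP' normP.
have posX := functional_Xsqr_gt0 uD uZ u_ge0 sizeP' leadP orthP' normP.
have c0 : 0 < 4 * z by rewrite mulr_gt0.
have pearson k : u ((4 * z) *: 'X^(k.+4) - k.+1%:R *: 'X^k) = 0 := freud_functional_Pearson k z0.
pose g := sop_coef (symmetrized u).
have g0 n : (0 < n)%N -> 0 < g n := @sop_coef_gt0 _ _ (symmetrized_gt0 uD uZ pos posX) n.
have gE := freud_equation uD uZ pos posX c0 pearson.
have ab := recurrence_coefficients uD uZ pos posX sizeP' leadP orthP' rec.
have c20 : 0 < (2 * (4 * z))^-1 by rewrite invr_gt0 mulr_gt0.
have lnP := freud_equation_asymptotics c20 g0 gE.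
pose q n : R := n%:R / (140 * z).
have q0 n : (0 < n)%N -> 0 < q n by move=> n0; rewrite divr_gt0 ?ltr0n ?mulr_gt0.
(* The shifts 0, 1, 2 give [g_(2n-1)], [g_(2n)], [g_(2n+1)]. With [1 / (8 z)] for the constant,
   [2 n / (8 z * 35) = n / (140 z)]. *)
have gq i : (i <= 2)%N -> asymp_equiv (fun n => g (n.*2 + i - 1)%N) (fun n => q n `^ (4^-1)).
  move=> i2; apply: log_asymp_equiv.
    apply: filterS (nbhs_infty_ge 1) => n /= n1; split; last exact/powR_gt0/q0.
    by apply: g0; lia.
  move=> e e0; have [N _ hN] := lnP e e0.
  exists N.+1 => // n /= nN.
  have n2 : (N <= n.*2)%N by lia.
  have := hN _ n2 (n.*2 + i - 1)%N.
  rewrite ln_powR (_ : _%:R * _ / 35 = q n); last first.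
    rewrite -muln2 natrM /q; field.
    by rewrite gt_eqF.
  by rewrite [4^-1 * _]mulrC; apply; lia.
have g1 := gq 0%N isT; have g2 := gq 1%N isT; have g3 := gq 2%N isT.
split.
- apply: (asymp_equiv_near _ (asymp_equivM g2 g1)).
  apply: filterS (nbhs_infty_ge 1) => -[//|n] _; cbv beta; split.
    have -> : (n.+1.*2 + 1 - 1 = n.*2.+2)%N by lia.
    have -> : (n.+1.*2 + 0 - 1 = n.*2.+1)%N by lia.
    by rewrite (ab n).1.
  have qn := q0 n.+1 isT.
  rewrite -powRD; last by rewrite gt_eqF ?implybT.
  have -> : 4^-1 + 4^-1 = 2^-1 :> R by field.
  exact: (powR12_sqrt (ltW qn)).
- apply: (asymp_equiv_near _ (asymp_equivD g3 g2)).
  apply: filterS (nbhs_infty_ge 1) => -[//|n] _; cbv beta; split=> //.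
  have -> : (n.+1.*2 + 1 - 1 = n.*2.+2)%N by lia.
  have -> : (n.+1.*2 + 2 - 1 = n.*2.+3)%N by lia.
  by rewrite (ab n).2.
Qed.
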